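(* For $Y\subset X$ let $I_Y=I\cap K[Y]$. If $I_Y$ has the König property for all $Y\subset X$ and $\overline{R[It]}$ is generated as a $K$-algebra by monomials of the form $x^at^b$ with $x^a$ square-free, then $R[It]$ is normal.
   Context: Let $R=K[x_1,\ldots,x_n]$ be a polynomial ring over a field $K$, $X=\{x_1,\ldots,x_n\}$, and let $I\subset R$ be an ideal of height $g\ge 2$ minimally generated by a finite set $F=\{x^{v_1},\ldots,x^{v_q}\}$ of square-free monomials of degree at least two (where $x^a=x_1^{a_1}\cdots x_n^{a_n}$). Each variable $x_i$ divides at least one monomial of $F$. A square-free monomial ideal corresponds to the clutter whose edges are the supports (sets of variables dividing the monomial) of its minimal monomial generators; $I_Y$ is an ideal of $K[Y]$, and its clutter consists of the edges of the clutter of $I$ contained in $Y$. For a clutter $\mathcal C$, $\alpha_0(\mathcal C)$ is the minimum cardinality of a vertex cover (a set of vertices meeting every edge) and $\beta_1(\mathcal C)$ is the maximum number of pairwise disjoint edges. An ideal has the König property if its clutter $\mathcal C$ satisfies $\alpha_0(\mathcal C)=\beta_1(\mathcal C)$ (trivially true when there are no edges). The Rees algebra is $R[It]=R\oplus It\oplus I^2t^2\oplus\cdots\subset R[t]$, $t$ a new variable; $\overline{R[It]}$ is its integral closure in its field of fractions, and $R[It]$ is normal if $R[It]=\overline{R[It]}$. *)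

(* Defs.v *)
From mathcomp Require Import all_boot all_order all_algebra.
From mathcomp Require Import boolp classical_sets.
From mathcomp Require Import mpoly.
Set Implicit Arguments.
Unset Strict Implicit.
Unset Printing Implicit Defensive.
Import GRing.Theory.
Local Open Scope ring_scope.
Local Open Scope classical_set_scope.

Section Ideals.
Variable R : comNzRingType.
Implicit Types (I P : set R) (k g : nat).

(* The library's [idealr_closed] only describes proper ideals; here the unit
   ideal is allowed, so that I ^ 0 below is the whole ring. *)
Definition ideal I : Prop :=
  [/\ I 0, forall x y, I x -> I y -> I (x + y) & forall a x, I x -> I (a * x)].

Definition ideal_gen (G : set R) : set R := smallest ideal G.

Definition minimally_generates (G I : set R) : Prop :=
  I = ideal_gen G /\ forall H : set R, H `<=` G -> I = ideal_gen H -> H = G.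

Definition ideal_pow I k : set R :=
  ideal_gen [set \prod_(i < k) f i | f in [set f : 'I_k -> R | forall i, I (f i)]].

Definition prime_ideal P : Prop :=
  [/\ ideal P, ~ P 1 & forall x y, P (x * y) -> P x \/ P y].

(* There is a chain c 0 < c 1 < ... < c k = P of prime ideals, that is,
   the height of P is at least k. *)
Definition prime_height_ge P k : Prop :=
  exists c : nat -> set R,
    [/\ forall i, (i <= k)%N -> prime_ideal (c i),
        forall i, (i < k)%N -> c i `<` c i.+1 & c k = P].

(* The height of I is the infimum of the heights of the primes containing I. *)
Definition ideal_height_ge I g : Prop :=
  forall P, prime_ideal P -> I `<=` P -> prime_height_ge P g.

Definition ideal_height I g : Prop :=
  ideal_height_ge I g /\ ~ ideal_height_ge I g.+1.

End Ideals.

Section IntegralClosure.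
Variable L : fieldType.
Implicit Type A : set L.

Definition frac_field_of A : set L :=
  [set x | exists a b, [/\ A a, A b, b != 0 & x = a / b]].

Definition integral_over A (x : L) : Prop :=
  exists p : {poly L}, [/\ p \is monic, forall i, A p`_i & root p x].

Definition integral_closure A : set L :=
  [set x | frac_field_of A x /\ integral_over A x].

End IntegralClosure.

Section Clutters.
Variable T : finType.
Implicit Types (E M : {set {set T}}) (C : {set T}).

Definition vertex_cover E C : bool :=
  [forall e in E, e :&: C != finset.set0].

(* [setT] is a vertex cover as soon as no edge is empty. *)
Definition alpha0 E : nat :=
  #|[arg min_(C < [set: T]%SET | vertex_cover E C) #|C|]|.

Definition beta1 E : nat :=
  \max_(M : {set {set T}} | (M \subset E) && finset.trivIset M) #|M|.

End Clutters.

Section MonomialIdeals.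
Variables (K : fieldType) (n : nat).
Local Notation R := {mpoly K[n]}.
Implicit Types (I : set R) (m : 'X_{1..n}) (Y : {set 'I_n}).

Definition squarefree_mon m : Prop := forall i, (m i <= 1)%N.

Definition mon_supp m : {set 'I_n} := [set i | 0 < m i]%N%SET.

(* x^m is a minimal generator of a monomial ideal I when it is minimal for
   divisibility among the monomials of I. *)
Definition min_mon_gen I m : Prop :=
  I 'X_[m] /\ forall m', I 'X_[m'] -> (m' <= m)%MM -> m' = m.

Definition clutter I : {set {set 'I_n}} :=
  [set e | `[< exists2 m, min_mon_gen I m & e = mon_supp m >]]%SET.

Definition konig I : Prop := alpha0 (clutter I) = beta1 (clutter I).

(* The subring K[Y] of R. *)
Definition poly_in Y : set R :=
  [set p | forall m, m \in msupp p -> mon_supp m \subset Y].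

(* I_Y is kept as a subset of R: its monomials, and the divisibility between
   them, are the same in K[Y] and in R. *)
Definition restr_ideal I Y : set R := I `&` poly_in Y.

End MonomialIdeals.

Section Rees.
Variables (K : fieldType) (n : nat).
Local Notation R := {mpoly K[n]}.

(* The fraction field of R[t]; it contains R[It] and its field of fractions. *)
Local Notation fracRt := {fraction {poly R}}.

Definition of_Rt (f : {poly R}) : fracRt := tofrac f.

Definition rees (I : set R) : set fracRt :=
  of_Rt @` [set f : {poly R} | forall k, ideal_pow I k f`_k].

Definition monXt (m : 'X_{1..n}) (b : nat) : fracRt := of_Rt ('X_[m] *: 'X^b).

Definition subalgebra (A : set fracRt) : Prop :=
  subring_closed [pred x in A] /\ forall c : K, A (of_Rt (c%:MP)%:P).

Definition subalgebra_gen (G : set fracRt) : set fracRt := smallest subalgebra G.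

Definition normal_rees (I : set R) : Prop :=
  rees I = integral_closure (rees I).

End Rees.

(* Main.v *)
Require Import Defs.
From mathcomp Require Import all_boot all_order all_algebra.
From mathcomp Require Import boolp classical_sets.
From mathcomp Require Import mpoly.

Import GRing.Theory.
Local Open Scope ring_scope.
Local Open Scope classical_set_scope.

(** Call x^a t^b one of the monomials that generate the integral closure, with
    x^a square-free, and let Y be the support of a.  As R[It] is a subalgebra,
    it suffices to show that x^a lies in I^b.

    Every vertex cover D of the clutter of I defines a monomial valuation,
    m |-> sum of the exponents m_i over i in D, which is at least k on I^k.
    Looking at one monomial in an equation of integral dependence of x^a t^b
    over R[It] shows that this valuation is at least b on x^a
    ([integral_monXt_weight_ge]).  If C is a minimum cover of the clutter of
    I_Y, then D = C together with the complement of Y is a cover of the clutter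
    of I, and its valuation at x^a is the cardinality of the intersection of C
    and Y.  Hence alpha0 of the clutter of I_Y is at least b.  By the König
    property there are b pairwise disjoint edges inside Y; the product of the
    corresponding generators of I is an element of I^b, and it divides x^a
    because the edges are disjoint ([prod_disjoint_in_pow]). *)

(** * Ideals and their powers *)

Section IdealPowers.
Context {R : comNzRingType}.
Implicit Types (I G J : set R) (k l : nat).

Lemma ideal_gen_ideal G : ideal (ideal_gen G).
Proof.
split.
- by move=> J [[J0 _ _] _].
- move=> x y Gx Gy J hJ; case: (hJ) => [[_ JD _] _].
  by apply: JD; [exact: Gx | exact: Gy].
- by move=> a x Gx J hJ; case: (hJ) => [[_ _ JM] _]; apply: JM; exact: Gx.
Qed.

Lemma ideal_gen_min {G J} : ideal J -> G `<=` J -> ideal_gen G `<=` J.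
Proof. by move=> iJ GJ x; apply. Qed.

Lemma sub_ideal_gen G : G `<=` ideal_gen G.
Proof. by move=> x Gx J [_]; apply. Qed.

Lemma ideal_pow_ideal I k : ideal (ideal_pow I k).
Proof. exact: ideal_gen_ideal. Qed.

Lemma prod_in_ideal_pow I k (f : 'I_k -> R) :
  (forall i, I (f i)) -> ideal_pow I k (\prod_(i < k) f i).
Proof. by move=> If; apply: sub_ideal_gen; exists f. Qed.

Lemma ideal_preim_mul J x : ideal J -> ideal [set y | J (x * y)].
Proof.
move=> [J0 JD JM]; split => /=.
- by rewrite mulr0.
- by move=> y z Jy Jz; rewrite mulrDr; apply: JD.
- by move=> a y Jy; rewrite mulrCA; apply: JM.
Qed.

Lemma ideal_powM I k l x y :
  ideal_pow I k x -> ideal_pow I l y -> ideal_pow I (k + l) (x * y).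
Proof.
have iP := ideal_pow_ideal I (k + l).
move=> Ix Iy; move: y Iy; apply: ideal_gen_min.
  exact: ideal_preim_mul iP.
move=> _ [g Ig <-] /=; rewrite mulrC; move: x Ix.
apply: (@ideal_gen_min _ [set x | ideal_pow I (k + l) (\prod_(i < l) g i * x)]).
  exact: ideal_preim_mul iP.
move=> _ [f If <-] /=; rewrite mulrC.
have -> : \prod_(i < k) f i * \prod_(i < l) g i =
    \prod_(i < k + l) match fintype.split i with inl a => f a | inr b => g b end.
  rewrite big_split_ord; congr (_ * _); apply: eq_bigr => i _.
    by rewrite -[lshift _ _]/(unsplit (inl i)) unsplitK.
  by rewrite -[rshift _ _]/(unsplit (inr i)) unsplitK.
by apply: prod_in_ideal_pow => i; case: (fintype.split i).
Qed.

Lemma ideal_pow0_full I x : ideal_pow I 0 x.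
Proof.
have [_ _ M] := ideal_pow_ideal I 0.
rewrite -[x]mulr1; apply: M.
have := prod_in_ideal_pow I 0 (fun=> 0); rewrite big_ord0; apply.
by case.
Qed.

Lemma ideal_sum {J : set R} (T : Type) (r : seq T) (P : pred T) (f : T -> R) :
  ideal J -> (forall i, P i -> J (f i)) -> J (\sum_(i <- r | P i) f i).
Proof. by move=> [J0 JD _] Jf; apply: (big_ind J). Qed.

Lemma idealB {J : set R} {x y} : ideal J -> J x -> J y -> J (x - y).
Proof. by move=> [_ JD JM] Jx Jy; apply: JD => //; rewrite -mulN1r; apply: JM. Qed.

End IdealPowers.

(** * Monomial ideals and weights of monomials *)

Section Monomials.
Context {K : fieldType} {n : nat}.
Local Notation R := {mpoly K[n]}.
Implicit Types (I : set R) (m a : 'X_{1..n}) (C D Y : {set 'I_n}).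

(** The monomials of a multiple of p are multiples of monomials of p.  A lower
    bound on the monomials of the generators of I, or of a power of I, passes to
    the whole ideal because the polynomials that satisfy it form an ideal. *)
Lemma ideal_upclosed (U : 'X_{1..n} -> Prop) :
  (forall m1 m2, (m1 <= m2)%MM -> U m1 -> U m2) ->
  ideal [set p : R | forall m, m \in msupp p -> U m].
Proof.
move=> Uup; split => /=.
- by move=> m; rewrite msupp0.
- move=> p q Up Uq m /msuppD_le; rewrite mem_cat => /orP[]; [exact: Up|exact: Uq].
- move=> p q Uq m /msuppM_le /allpairsP[[m1 m2] /= [_ /Uq Um2 ->]].
  by apply: Uup Um2; apply: lem_addl.
Qed.

Lemma mon_in_monomial_ideal q (v : 'I_q -> 'X_{1..n}) p :
  ideal_gen [set ('X_[v j] : R) | j in [set: 'I_q]] p ->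
  forall m, m \in msupp p -> exists j, (v j <= m)%MM.
Proof.
move: p; apply: ideal_gen_min.
  apply: ideal_upclosed => m1 m2 m12 [j vj]; exists j.
  exact: lepm_trans vj m12.
move=> _ [j _ <-] m /=; rewrite msuppX inE => /eqP->; exists j.
exact: lepm_refl.
Qed.

Definition weight D m : nat := \sum_(i in D) m i.

Lemma weightD D m1 m2 : weight D (m1 + m2)%MM = (weight D m1 + weight D m2)%N.
Proof. by rewrite /weight -big_split; apply: eq_bigr => i _; rewrite mnmDE. Qed.

Lemma weight_mulmn D m k : weight D (m *+ k)%MM = (weight D m * k)%N.
Proof. by rewrite /weight big_distrl; apply: eq_bigr => i _; rewrite mulmnE. Qed.

Lemma leq_weight D m1 m2 : (m1 <= m2)%MM -> (weight D m1 <= weight D m2)%N.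
Proof. by move=> /mnm_lepP h; apply: leq_sum. Qed.

Lemma weight_gt0 D m i : i \in D -> (0 < m i)%N -> (0 < weight D m)%N.
Proof. by move=> iD mi; rewrite /weight (bigD1 i) //= ltn_addr. Qed.

(** A weight is additive on products of monomials, hence it is at least k on
    I^k as soon as it is at least 1 on I. *)
Lemma ideal_pow_weight I D k p :
  (forall f m, I f -> m \in msupp f -> (0 < weight D m)%N) ->
  ideal_pow I k p -> forall m, m \in msupp p -> (k <= weight D m)%N.
Proof.
move=> ID; move: p; apply: ideal_gen_min.
  apply: ideal_upclosed => m1 m2 m12 h.
  exact: leq_trans h (leq_weight _ _ _ m12).
move=> _ [f If <-] /=; elim: k f If => [|k IH] f If m; first by rewrite leq0n.
rewrite big_ord_recl => /msuppM_le /allpairsP[[m1 m2] /= [h1 h2 ->]].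
rewrite weightD -add1n leq_add //; first exact: ID (If _) h1.
by apply: IH h2 => i; apply: If.
Qed.

(** Each variable occurs in at most one of the monomials u i, so their product,
    which lies in I^b, divides x^a because each of them does. *)
Lemma prod_disjoint_in_pow I b (u : 'I_b -> 'X_{1..n}) a :
  (forall i, I 'X_[u i]) -> (forall i, (u i <= a)%MM) ->
  (forall i j k, (0 < u i k)%N -> (0 < u j k)%N -> i = j) ->
  ideal_pow I b 'X_[a].
Proof.
move=> Iu ua udisj.
have sa : (\sum_(i < b) u i <= a)%MM.
  apply/mnm_lepP => k; rewrite mnm_sumE.
  case: (pickP (fun i => 0 < u i k)%N) => [i0 h0|h0].
    rewrite (bigD1 i0) //= big1 ?addn0; first exact/mnm_lepP.
    move=> i ni; apply/eqP; rewrite -leqn0 leqNgt; apply/negP => hi.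
    by move/eqP: ni; apply; apply: udisj hi h0.
  by rewrite big1 // => i _; apply/eqP; rewrite -leqn0 leqNgt h0.
rewrite -(submK sa) mpolyXD.
have [_ _ M] := ideal_pow_ideal I b.
by apply: M; rewrite -mprodXE; apply: prod_in_ideal_pow.
Qed.

End Monomials.

(** * The clutter of the monomials of an ideal *)

Section Clutters.
Context {K : fieldType} {n : nat}.
Local Notation R := {mpoly K[n]}.
Implicit Types (I : set R) (m a : 'X_{1..n}) (C D Y : {set 'I_n}).

Lemma clutterP I e :
  reflect (exists2 m, min_mon_gen I m & e = mon_supp m) (e \in clutter I).
Proof. by rewrite inE; exact: asboolP. Qed.

Lemma mon_suppE m i : (i \in mon_supp m) = (0 < m i)%N.
Proof. by rewrite inE. Qed.

Lemma mon_suppS m1 m2 : (m1 <= m2)%MM -> mon_supp m1 \subset mon_supp m2.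
Proof.
move=> /mnm_lepP h; apply/fintype.subsetP => i; rewrite !mon_suppE => h1.
exact: leq_trans h1 (h i).
Qed.

Lemma restr_mon I Y m : restr_ideal I Y 'X_[m] <-> I 'X_[m] /\ mon_supp m \subset Y.
Proof.
split=> -[Im h]; split => //.
  by apply: h; rewrite msuppX inE.
by move=> m'; rewrite msuppX inE => /eqP->.
Qed.

Lemma ex_min_mon I m : I 'X_[m] -> exists2 m', min_mon_gen I m' & (m' <= m)%MM.
Proof.
have [d] := ubnP (mdeg m); elim: d m => // d IH m; rewrite ltnS => md Im.
case: (pselect (exists m', [/\ I 'X_[m'], (m' <= m)%MM & m' <> m])) => [|hno].
  move=> [m' [Im' m'm ne]].
  have lt : (mdeg m' < d)%N.
    apply: leq_trans md; rewrite -(submK m'm) mdegD -[X in (X < _)%N]add0n.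
    rewrite ltn_add2r lt0n mdeg_eq0; apply/negP => /eqP e0.
    by apply: ne; rewrite -[RHS](submK m'm) e0 add0m.
  have [m'' h le] := IH _ lt Im'; exists m'' => //.
  exact: lepm_trans le m'm.
exists m; last exact: lepm_refl.
by split=> // m' Im' m'm; apply: contrapT => ne; apply: hno; exists m'.
Qed.

(** The complement of Y takes care of the edges that are not inside Y.  Adding it
    turns a cover for I_Y into one for I, whose weight is positive on all of I;
    and it adds nothing to the weight of a monomial supported in Y. *)
Lemma cover_extend I Y C m :
  vertex_cover (clutter (restr_ideal I Y)) C -> I 'X_[m] ->
  (0 < weight (C :|: ~: Y)%SET m)%N.
Proof.
move=> /forallP covC Im; case: (boolP (mon_supp m \subset Y)) => [mY|].
  have [m' h m'm] := ex_min_mon _ _ (proj2 (restr_mon _ _ _) (conj Im mY)).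
  have eC : mon_supp m' \in clutter (restr_ideal I Y).
    by apply/clutterP; exists m'.
  have /implyP/(_ eC)/set0Pn[i] := covC (mon_supp m').
  rewrite finset.inE mon_suppE => /andP[m'i iC].
  apply: (@weight_gt0 _ _ _ i); first by rewrite finset.inE iC.
  by move/mnm_lepP: m'm => /(_ i); apply: leq_trans.
move=> /fintype.subsetPn[i]; rewrite mon_suppE => mi iY.
by apply: (@weight_gt0 _ _ _ i) => //; rewrite !finset.inE iY orbT.
Qed.

(** Without an empty edge the whole vertex set is a cover, as the starting point
    of the minimization in [alpha0] has to be. *)
Lemma alpha0_attained (T : finType) (E : {set {set T}}) :
  finset.set0 \notin E -> exists2 C, vertex_cover E C & #|C| = alpha0 E.
Proof.
move=> E0; rewrite /alpha0; case: arg_minnP => [|C hC _]; last by exists C.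
apply/forallP => e; apply/implyP => eE; rewrite finset.setIT.
by apply: contraNneq E0 => <-.
Qed.

Lemma beta1_attained (T : finType) (E : {set {set T}}) :
  exists M : {set {set T}}, [/\ M \subset E, finset.trivIset M & #|M| = beta1 E].
Proof.
have [|M /andP[ME tM] eM] := @eq_bigmax_cond _
  [pred M : {set {set T}} | (M \subset E) && finset.trivIset M]
  (fun M : {set {set T}} => #|M|).
  apply/card_gt0P; exists finset.set0; rewrite inE /= finset.sub0set /=.
  by apply/finset.trivIsetP => A B; rewrite finset.inE.
by exists M; split => //; rewrite /beta1 eM.
Qed.

End Clutters.

(** * Rees algebras *)

Section ReesAlgebras.
Context {K : fieldType} {n : nat}.
Local Notation R := {mpoly K[n]}.
Implicit Types (I : set R) (m a : 'X_{1..n}).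

Lemma subring_closed_set {S : nzRingType} (A : set S) :
  subring_closed [pred x in A] <->
  [/\ A 1, forall x y, A x -> A y -> A (x - y) &
      forall x y, A x -> A y -> A (x * y)].
Proof.
have mE x : x \in [pred y in A] <-> A x by split=> /asboolP.
split=> -[A1 AB AM]; split.
- exact/mE.
- by move=> x y /mE Ax /mE Ay; apply/mE; apply: AB.
- by move=> x y /mE Ax /mE Ay; apply/mE; apply: AM.
- exact/mE.
- by move=> x y /mE Ax /mE Ay; apply/mE; apply: AB.
- by move=> x y /mE Ax /mE Ay; apply/mE; apply: AM.
Qed.

Lemma rees_subalgebra I : subalgebra (rees I).
Proof.
have iP := ideal_pow_ideal I; split; last first.
  move=> c; exists (c%:MP)%:P => // -[|k]; first exact: ideal_pow0_full.
  by rewrite coefC /=; case: (iP k.+1).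
apply/subring_closed_set; split.
- exists 1; last by rewrite /of_Rt rmorph1.
  move=> [|k]; first exact: ideal_pow0_full.
  by rewrite coef1; case: (iP k.+1).
- move=> _ _ [f If <-] [g Ig <-]; exists (f - g); last by rewrite /of_Rt rmorphB.
  by move=> k; rewrite coefB; apply: (idealB (iP k)); [exact: If|exact: Ig].
- move=> _ _ [f If <-] [g Ig <-]; exists (f * g); last by rewrite /of_Rt rmorphM.
  move=> k; rewrite coefM; apply: (ideal_sum _ _ _ _ (iP k)) => i _.
  by rewrite -[in ideal_pow I k](subnKC (leq_ord i)); apply: ideal_powM.
Qed.

Lemma sub_integral_closure {L : fieldType} (A : set L) :
  subring_closed [pred x in A] -> A `<=` integral_closure A.
Proof.
move=> /subring_closed_set[A1 B _].
have A0 : A 0 by rewrite -(subrr 1); apply: B.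
move=> x Ax; split; first by exists x, 1; rewrite oner_eq0 divr1.
exists ('X - x%:P); split; [exact: monicXsubC| |by rewrite root_XsubC].
move=> i; rewrite coefB coefX coefC; apply: B.
  by case: (i == 1%N).
by case: (i == 0%N).
Qed.

Lemma of_Rt_inj : injective (@of_Rt K n).
Proof. by move=> f g /eqP; rewrite tofrac_eq => /eqP. Qed.

(** In an equation of integral dependence z^N + c_(N-1) z^(N-1) + ... + c_0 = 0
    of z = x^a t^b, the term z^N = x^(Na) t^(Nb) must be cancelled, hence this
    monomial occurs in some c_i z^i; then x^(ka) t^(kb) occurs in c_i, with
    k = N - i. *)
Lemma integral_monXt_coef I a b :
  integral_over (rees I) (monXt K a b) ->
  exists k p, [/\ (0 < k)%N, ideal_pow I (b * k) p & (a *+ k)%MM \in msupp p].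
Proof.
move=> [p [pmon Ip rp]].
have /choice[f hf] : forall i, exists f : {poly R},
    (forall k, ideal_pow I k f`_k) /\ of_Rt f = p`_i.
  by move=> i; have [f] := Ip i; exists f.
have p0 : size p != 0%N by rewrite size_poly_eq0 monic_neq0.
set N := (size p).-1.
have sN : size p = N.+1 by rewrite /N prednK // lt0n.
have fN : f N = 1.
  apply: of_Rt_inj; rewrite [RHS]rmorph1.
  by have [_] := hf N; move=> ->; move/monicP: pmon.
have : \sum_(i < N.+1) f i * ('X_[a] *: 'X^b) ^+ i = 0.
  apply: of_Rt_inj; rewrite [RHS]rmorph0 [LHS]rmorph_sum /=.
  move/rootP: rp; rewrite horner_coef sN; apply: etrans; apply: eq_bigr => i _.
  by rewrite rmorphM rmorphXn; have [_ <-] := hf i.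
move/(congr1 (fun h : {poly R} => h`_(b * N)@_(a *+ N)%MM)).
rewrite coef0 mcoeff0 coef_sum raddf_sum /=.
have cE (i : 'I_N.+1) : (f i * ('X_[a] *: 'X^b) ^+ i)`_(b * N)@_(a *+ N)%MM
    = (f i)`_(b * (N - i))@_(a *+ (N - i))%MM.
  have iN := leq_ord i.
  rewrite exprZn -exprM -scalerAr coefZ coefMXn ltnNge leq_mul2l iN orbT /=.
  rewrite -mulnBr [X in X@__]mulrC mpolyXn.
  have -> : (a *+ N)%MM = (a *+ i + a *+ (N - i))%MM.
    by apply/mnmP => j; rewrite mnmDE !mulmnE -mulnDr subnKC.
  by rewrite mcoeffMX.
rewrite (eq_bigr _ (fun i _ => cE i)) big_ord_recr /= subnn muln0 fN coef1 /=.
have -> : (1 : R)@_(a *+ 0)%MM = 1 by rewrite mulm0n mcoeff1 eqxx.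
move=> s0.
have [i hi] : exists i : 'I_N, (f i)`_(b * (N - i))@_(a *+ (N - i))%MM != 0.
  apply: contrapT => hno; move: s0; rewrite big1 ?add0r.
    by move/eqP; rewrite oner_eq0.
  move=> i _; apply/eqP; apply: contrapT => /negP h; apply: hno.
  by exists i.
exists (N - i)%N, (f i)`_(b * (N - i)); split.
- by rewrite subn_gt0.
- by have [+ _] := hf i; apply.
- by rewrite mcoeff_msupp.
Qed.

(** If x^(ka) occurs in an element of I^(kb), its weight k * weight D a is at least
    k b, and k can be cancelled. *)
Lemma integral_monXt_weight_ge I (D : {set 'I_n}) a b :
  (forall f m, I f -> m \in msupp f -> (0 < weight D m)%N) ->
  integral_over (rees I) (monXt K a b) -> (b <= weight D a)%N.
Proof.
move=> ID /integral_monXt_coef[k [p [k0 Ip ap]]].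
have := ideal_pow_weight _ _ _ _ ID Ip _ ap.
by rewrite weight_mulmn leq_pmul2r.
Qed.

Lemma monXt_rees I a b : ideal_pow I b 'X_[a] -> rees I (monXt K a b).
Proof.
move=> Ia; exists ('X_[a] *: 'X^b) => // k.
rewrite coefZ coefXn; case: eqP => [->|_]; first by rewrite mulr1.
by rewrite mulr0; case: (ideal_pow_ideal I k).
Qed.

(** * Square-free integral monomials under the König property *)

(** A minimum cover for I_Y, viewed as a monomial valuation, shows that b is at
    most [alpha0]; the König property turns this bound into b disjoint
    edges inside Y, on which a is identically 1. *)
Lemma konig_squarefree_integral q (v : 'I_q -> 'X_{1..n}) I a b :
  (forall j, squarefree_mon (v j)) -> (forall j, v j != 0%MM) ->
  I = ideal_gen [set 'X_[v j] | j in [set: 'I_q]] ->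
  konig (restr_ideal I (mon_supp a)) -> squarefree_mon a ->
  integral_over (rees I) (monXt K a b) -> ideal_pow I b 'X_[a].
Proof.
move=> vsqf v0 IE; set Y := mon_supp a; set E := clutter (restr_ideal I Y).
rewrite /konig -/E => kon asqf intab.
have Iv j : I 'X_[v j] by rewrite IE; apply: sub_ideal_gen; exists j.
have monI f m : I f -> m \in msupp f -> exists j, (v j <= m)%MM.
  by rewrite IE => If; apply: mon_in_monomial_ideal.
have edgeE e : e \in E -> exists j, e = mon_supp (v j) /\ e \subset Y.
  move=> /clutterP[m [/restr_mon[Im mY] mmin] eE].
  have [j vjm] : exists j, (v j <= m)%MM.
    by apply: (monI _ _ Im); rewrite msuppX inE.
  exists j; rewrite eE; split=> //; rewrite (mmin (v j)) //.
  apply/restr_mon; split => //.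
  exact: fintype.subset_trans (mon_suppS _ _ vjm) mY.
have E0 : finset.set0 \notin E.
  apply/negP => /edgeE[j [e0 _]]; move/negP: (v0 j); apply; apply/eqP/mnmP => i.
  apply/eqP; rewrite mnm0E -leqn0 leqNgt -mon_suppE -e0.
  by rewrite finset.inE.
have bE : (b <= beta1 E)%N.
  rewrite -kon; have [C covC <-] := alpha0_attained _ _ E0.
  apply: (@leq_trans (weight (C :|: ~: Y)%SET a)).
    apply: integral_monXt_weight_ge intab => f m If mf.
    have [j vjm] := monI _ _ If mf.
    apply: leq_trans (leq_weight _ _ _ vjm).
    exact: cover_extend covC (Iv j).
  (* a is 1 on Y and 0 outside, so its weight only counts elements of C. *)
  rewrite /weight -sum1_card big_mkcond [X in (_ <= X)%N]big_mkcond.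
  apply: leq_sum => i _; rewrite !finset.inE.
  case: (i \in C) => /=; first exact: asqf.
  by case: (posnP (a i)) => [->|].
have [M [ME tM cM]] := beta1_attained _ E.
rewrite -cM in bE.
have /choice[w hw] : forall i : 'I_b, exists j,
    enum_val (widen_ord bE i) = mon_supp (v j) /\ mon_supp (v j) \subset Y.
  move=> i; have /(fintype.subsetP ME)/edgeE[j [e1 e2]] :=
    enum_valP (widen_ord bE i).
  by exists j; rewrite -e1.
apply: (prod_disjoint_in_pow _ _ (fun i => v (w i))) => [i|i|i j k ik jk].
- exact: Iv.
- apply/mnm_lepP => k; case: (posnP (v (w i) k)) => [->//|vk].
  apply: leq_trans (vsqf _ k) _; have [_ /fintype.subsetP/(_ k)] := hw i.
  by rewrite !mon_suppE; apply.
- suff /(congr1 val) eij : widen_ord bE i = widen_ord bE j by apply: val_inj.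
  apply: enum_val_inj; have [ei _] := hw i; have [ej _] := hw j.
  apply/eqP; apply: contraT => /(finset.trivIsetP tM _ _ (enum_valP _) (enum_valP _)).
  by rewrite ei ej => /pred0P/(_ k) /=; rewrite !mon_suppE ik jk.
Qed.

End ReesAlgebras.

Theorem proposition4p32 (K : fieldType) (n g q : nat)
  (v : 'I_q -> 'X_{1..n}) (I : set {mpoly K[n]})
  (hsqf : forall j, squarefree_mon (v j))
  (hdeg : forall j, (2 <= mdeg (v j))%N)
  (hI : minimally_generates [set 'X_[v j] | j in [set: 'I_q]] I)
  (hheight : ideal_height I g) (hg : (2 <= g)%N)
  (hvar : forall i : 'I_n, exists j, (0 < v j i)%N)
  (hkonig : forall Y : {set 'I_n}, konig (restr_ideal I Y))
  (hgen : exists2 S : set ('X_{1..n} * nat),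
      (forall ab, S ab -> squarefree_mon ab.1) &
      integral_closure (rees I) =
        subalgebra_gen [set monXt K ab.1 ab.2 | ab in S]) :
  normal_rees I.
Proof.
have [sub _] := rees_subalgebra I.
apply/seteqP; split; first exact: sub_integral_closure.
case: hgen => S Ssqf SE; rewrite SE => x; apply; split.
  exact: rees_subalgebra.
move=> _ [[a b] Sab <-] /=; apply: monXt_rees.
apply: (konig_squarefree_integral _ v) => //.
- by move=> j; rewrite -mdeg_eq0 -lt0n; apply: leq_trans (hdeg j).
- by case: hI.
- exact: Ssqf Sab.
- suff [] : integral_closure (rees I) (monXt K a b) by [].
  by rewrite SE => A [_]; apply; exists (a, b).
Qed.
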